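(* Let $t\ge 1$ be an integer, let $r=2t$, let $K$ be a field, let $R=K[X_1,\dots,X_{3t+3}]$, and let $\mathcal{I}\subset R$ be the edge ideal of the graph $B_{2t}$. If $$\cdots \to R^{c}(-4)\oplus R^{b}(-3)\to R^{q}(-2)\to R\to R/\mathcal{I}\to 0$$ is the minimal graded free resolution of $R/\mathcal{I}$, then 1) $q=\frac{5}{2}r+2$; 2) $b=6r-2$.
   Context: For an integer $t\ge 1$, $B_{2t}$ is the simple graph with vertex set $\{v_1,\dots,v_{3t+3}\}$ and edge set $\{\{v_i,v_{i+1}\} : 1\le i\le 3t+2,\ i\ne t+1,\ i\neq 2t+2\}\cup\{\{v_i,v_{i+t+1}\} : 1\le i\le 2t+2\}$ (a grid of unit squares with 2 rows and $t$ columns of squares); $r=2t$ is its number of (bounded) regions. The edge ideal of a graph on $v_1,\dots,v_n$ is the ideal of $K[X_1,\dots,X_n]$ generated by all monomials $X_iX_j$ with $\{v_i,v_j\}$ an edge. Thus $q$ is the graded Betti number of $R/\mathcal{I}$ in homological degree 1 and internal degree 2, and $b$ the one in homological degree 2 and internal degree 3. *)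

(* Defs.v *)
From HB Require Import structures.
From mathcomp Require Import all_boot all_order all_algebra.
From mathcomp Require Export mpoly.

Set Implicit Arguments.
Unset Strict Implicit.
Unset Printing Implicit Defensive.

Import GRing.Theory.

Local Open Scope ring_scope.

(* Vertices are labelled v_1, ..., v_(3t+3), so a and b are 1-based labels;
   an edge is listed here once, with its smaller label a first. *)
Definition grid_edge (t a b : nat) : bool :=
  [|| [&& 1 <= a <= 3 * t + 2, a != t + 1, a != 2 * t + 2 & b == a + 1]
    | (1 <= a <= 2 * t + 2) && (b == a + t + 1)]%N.

(* The ordinal i : 'I_(3 * t + 3) stands for the vertex v_(i+1). *)
Definition B2t (t : nat) : rel 'I_(3 * t + 3) :=
  fun i j => grid_edge t i.+1 j.+1 || grid_edge t j.+1 i.+1.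

Lemma B2t_sym (t : nat) : ssrbool.symmetric (@B2t t).
Proof. by move=> i j; rewrite /B2t orbC. Qed.

Lemma B2t_irrefl (t : nat) : irreflexive (@B2t t).
Proof.
move=> i; rewrite /B2t orbb /grid_edge -addnA.
have neq k : (0 < k)%N -> (i.+1 == i.+1 + k)%N = false.
  by move=> k_gt0; rewrite -{1}[i.+1]addn0 eqn_add2l ltn_eqF.
by rewrite !neq ?addn1 // !andbF.
Qed.

Definition in_ideal (A : comNzRingType) (S : A -> Prop) (p : A) : Prop :=
  exists2 s : seq (A * A),
    (forall x, x \in s -> S x.2) & p = \sum_(x <- s) x.1 * x.2.

Definition edge_ideal (K : fieldType) (n : nat) (e : rel 'I_n)
    (p : {mpoly K[n]}) : Prop :=
  in_ideal (fun g => exists i j : 'I_n, e i j /\ g = 'X_i * 'X_j) p.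

Definition irrelevant_ideal (K : fieldType) (n : nat)
    (p : {mpoly K[n]}) : Prop :=
  in_ideal (fun g => exists i : 'I_n, g = 'X_i) p.

(* F_i is the direct sum of the R(-d), d ranging over the list [twists i].
   Elements of F_i are row vectors, and the map F_(i+1) -> F_i is
   v |-> v *m differential i. *)
Record free_seq (K : fieldType) (n : nat) := FreeSeq {
  twists : nat -> seq int;
  differential : forall i : nat,
    'M[{mpoly K[n]}]_(size (twists i.+1), size (twists i))
}.

(* Unlike [dhomog], the degree may be negative, and then p = 0. *)
Definition zhomog (K : fieldType) (n : nat) (d : int) (p : {mpoly K[n]}) :
    Prop :=
  forall m, m \in msupp p -> (mdeg m)%:Z = d.

(* [resolves] identifies F_0 = R, a free module of rank one, with R through
   [const_mx]; it is exactness at F_0 of F_1 -> F_0 = R -> R/I -> 0. *)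
Record minimal_graded_free_resolution (K : fieldType) (n : nat)
    (I : {mpoly K[n]} -> Prop) (F : free_seq K n) : Prop := {
  starts_with_ring : twists F 0 = [:: 0];
  graded : forall (i : nat) (j : 'I_(size (twists F i.+1)))
      (k : 'I_(size (twists F i))),
    zhomog ((twists F i.+1)`_j - (twists F i)`_k) (differential F i j k);
  resolves : forall p : {mpoly K[n]},
    I p <-> exists w : 'rV_(size (twists F 1)),
      w *m differential F 0 = const_mx p;
  exactness : forall (i : nat) (v : 'rV_(size (twists F i.+1))),
    v *m differential F i = 0 <->
    exists w : 'rV_(size (twists F i.+2)), w *m differential F i.+1 = v;
  minimality : forall i j k, irrelevant_ideal (differential F i j k)
}.

(* Main.v *)
(* Let I be the edge ideal. By exactness and minimality the q generators form
   a basis of the degree 2 part I_2, and the b rows of twist 3 form a basis of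
   the kernel of the multiplication map (R_1)^q -> I_3. Since I_2 and I_3 have
   monomial bases, q is the number of edges and b = q n - dim I_3.

   A cubic monomial of I is a vertex times an edge. For a triangle-free graph
   this factorization is unique, except that a path k - i - j gives the two
   factorizations x_k (x_i x_j) = x_j (x_k x_i). Hence b is the number of paths
   with two edges, that is, 2 b is the sum of d^2 - d over the vertex degrees
   d. In the grid, 4 vertices have degree 2, 2 t have degree 3 and t - 1 have
   degree 4. *)
From HB Require Import structures.
Require Import Defs.
From mathcomp Require Import all_boot all_order all_algebra.
From mathcomp Require Import zify.

Set Implicit Arguments.
Unset Strict Implicit.
Unset Printing Implicit Defensive.

Import GRing.Theory.

Local Open Scope ring_scope.

(** * Free resolutions of ideals generated by quadrics *)

Lemma dim_mx (K : fieldType) (m p : nat) : dim 'M[K]_(m, p) = (m * p)%N.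
Proof. exact: dim_matrix. Qed.

(** Rank-nullity for [g], whose kernel is a copy of [U]. Both Betti numbers come from such a
    dimension count over [K]. *)
Lemma dim_short_exact (K : fieldType) (U V W : vectType K)
    (f : U -> V) (g : V -> W) :
    linear f -> linear g -> injective f ->
    (forall v, g v = 0 <-> exists u, f u = v) ->
    (forall w, exists v, g v = w) ->
  dim V = (dim U + dim W)%N.
Proof.
move=> f_lin g_lin f_inj fg_exact g_surj.
pose fL : {linear U -> V} := HB.pack f (GRing.isLinear.Build _ _ _ _ f f_lin).
pose gL : {linear V -> W} := HB.pack g (GRing.isLinear.Build _ _ _ _ g g_lin).
pose fh := linfun fL; pose gh := linfun gL.
have gh_full : limg gh = fullv.
  apply/vspaceP=> w; rewrite memvf; have [v gv] := g_surj w.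
  by apply/memv_imgP; exists v; rewrite ?memvf // lfunE /= gv.
have fh_ker0 : lker fh == 0%VS.
  by apply/lker0P=> u v; rewrite !lfunE /=; apply: f_inj.
have fh_ker : limg fh = lker gh.
  apply/vspaceP=> v; rewrite memv_ker lfunE /=.
  apply/memv_imgP/eqP=> [[u _ ->]|/fg_exact[u <-]].
    by rewrite lfunE /=; apply/fg_exact; exists u.
  by exists u; rewrite ?memvf // lfunE.
rewrite -!dimvf -(limg_ker_dim gh fullv) capfv -fh_ker gh_full; congr (_ + _)%N.
by rewrite limg_dim_eq // (eqP fh_ker0) capv0.
Qed.


(** * Coefficients of products of polynomials *)

(** A factorization of a monomial of degree [d] can take only the constant monomial from [p], since
    the factor from [g] already has degree at least [d]. *)
Lemma mcoeffM_lowest (R : comNzRingType) (n d : nat) (p g : {mpoly R[n]}) m :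
    (forall m', m' \in msupp g -> (d <= mdeg m')%N) -> mdeg m = d ->
  (p * g)@_m = p@_0%MM * g@_m.
Proof.
move=> g_low dm; rewrite -[p in LHS](subrK (p@_0%MM)%:MP) mulrDl mcoeffD.
rewrite mcoeffCM; set D := p - _.
suff -> : (D * g)@_m = 0 by rewrite add0r.
apply/eqP; rewrite mcoeff_eq0; apply/negP=> /msuppM_le /allpairsP[[m1 m2] /=].
case=> m1D /g_low d_m2 em.
have : mdeg m1 == 0%N by have := congr1 mdeg em; rewrite mdegD; lia.
rewrite mdeg_eq0 => /eqP m1_0; move: m1D.
by rewrite mcoeff_msupp m1_0 mcoeffB mcoeffC eqxx mulr1 subrr eqxx.
Qed.

Definition linear_form (R : comNzRingType) (n : nat) (a : 'I_n -> R) :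
  {mpoly R[n]} := \sum_k a k *: 'X_k.

Lemma mcoeff_linear_form (R : comNzRingType) (n : nat) (a : 'I_n -> R) k :
  (linear_form a)@_U_(k)%MM = a k.
Proof.
rewrite raddf_sum /= (bigD1 k) //= mcoeffZ mcoeffXU eqxx mulr1.
rewrite big1 ?addr0 // => j /negPf neq_jk.
by rewrite mcoeffZ mcoeffXU neq_jk mulr0.
Qed.

Lemma linear_form_homog (R : comNzRingType) (n : nat) (a : 'I_n -> R) :
  linear_form a \is 1.-homog.
Proof. by apply: rpred_sum => k _; apply: rpredZ; rewrite dhomogX /= mdeg1. Qed.

Lemma linear_formE (R : comNzRingType) (n : nat) (p : {mpoly R[n]}) :
  p \is 1.-homog -> p = linear_form (fun k => p@_U_(k)%MM).
Proof.
move=> p_hom; apply/mpolyP=> m.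
have [/mdeg1P[k /eqP->]|dm] := boolP (mdeg m == 1%N).
  by rewrite mcoeff_linear_form.
rewrite (dhomog_nemf_coeff p_hom) ?(dhomog_nemf_coeff (linear_form_homog _)) //.
Qed.

Lemma mcoeff_linear_formM (R : comNzRingType) (n : nat) (a : 'I_n -> R)
    (g : {mpoly R[n]}) m :
  (linear_form a * g)@_m = \sum_k a k * ('X_k * g)@_m.
Proof.
rewrite mulr_suml raddf_sum /=; apply: eq_bigr => k _.
by rewrite -scalerAl mcoeffZ.
Qed.

(** The factor from [g] uses up [d] of the [d.+1] degrees, so [p] may be replaced by its linear
    part. *)
Lemma mcoeffM_homog_linear (R : comNzRingType) (n d : nat)
    (p g : {mpoly R[n]}) m :
    g \is d.-homog -> mdeg m = d.+1 ->
  (p * g)@_m = \sum_k p@_U_(k)%MM * ('X_k * g)@_m.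
Proof.
move=> /dhomogP g_hom dm; rewrite -mcoeff_linear_formM.
apply/eqP; rewrite -subr_eq0 -mcoeffB -mulrBl mcoeff_eq0.
apply/negP=> /msuppM_le /allpairsP[[m1 m2] /= [m1D /g_hom /= dm2 em]].
have : mdeg m1 == 1%N by have := congr1 mdeg em; rewrite mdegD; lia.
case/mdeg1P=> k /eqP m1_k; move: m1D.
by rewrite mcoeff_msupp m1_k mcoeffB mcoeff_linear_form subrr eqxx.
Qed.

(** * Consequences of minimality and exactness *)

Lemma irrelevant_ideal_mcoeff0 (K : fieldType) (n : nat) (p : {mpoly K[n]}) :
  irrelevant_ideal p -> p@_0%MM = 0.
Proof.
case=> s sX ->; rewrite raddf_sum /= big_seq big1 // => x /sX[i ->].
by rewrite rmorphM /= mcoeffX mnm1_eq0 mulr0.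
Qed.

Lemma irrelevant_ideal_mdeg (K : fieldType) (n : nat) (p : {mpoly K[n]}) m :
  irrelevant_ideal p -> m \in msupp p -> (1 <= mdeg m)%N.
Proof.
move=> /irrelevant_ideal_mcoeff0 p0; rewrite mcoeff_msupp lt0n mdeg_eq0.
by apply: contraNneq => ->; rewrite p0.
Qed.

(** Exactness writes [c] as an image of the next differential, whose entries have no constant term
    by minimality. Thus the rows of each differential are linearly independent over [K]. *)
Lemma const_syzygy_eq0 (K : fieldType) (n : nat) (I : {mpoly K[n]} -> Prop)
    (F : free_seq K n) (i : nat) (c : 'rV[K]_(size (twists F i.+1))) :
    minimal_graded_free_resolution I F ->
  map_mx (@mpolyC n K) c *m differential F i = 0 -> c = 0.
Proof.
move=> hF /(exactness hF)[w ew]; apply/rowP=> j.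
have /(congr1 (mcoeff 0%MM)) : (w *m differential F i.+1) 0 j = (c 0 j)%:MP.
  by rewrite ew mxE.
rewrite mxE mcoeffC eqxx mulr1 mxE raddf_sum => <-; apply: big1 => l _ /=.
rewrite rmorphM /= (irrelevant_ideal_mcoeff0 (minimality hF l j)); exact: mulr0.
Qed.

(** The size of [twists F 0] is 1 by a proved equality and not by conversion, so the only index of
    F_0 is passed around as [k0]. *)
Lemma resolution_row0 (K : fieldType) (n : nat) (I : {mpoly K[n]} -> Prop)
    (F : free_seq K n) (k0 : 'I_(size (twists F 0)))
    (u v : 'rV[{mpoly K[n]}]_(size (twists F 0))) :
  minimal_graded_free_resolution I F -> u 0 k0 = v 0 k0 -> u = v.
Proof.
move=> hF uv; apply/rowP=> k; suff -> : k = k0 by [].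
have sz1 : size (twists F 0) = 1%N by rewrite (starts_with_ring hF).
by apply: val_inj => /=; have := ltn_ord k; have := ltn_ord k0; lia.
Qed.

Lemma resolution_idealP (K : fieldType) (n : nat) (I : {mpoly K[n]} -> Prop)
    (F : free_seq K n) (k0 : 'I_(size (twists F 0))) p :
    minimal_graded_free_resolution I F ->
  I p <-> exists w : 'I_(size (twists F 1)) -> {mpoly K[n]},
            p = \sum_j w j * differential F 0 j k0.
Proof.
move=> hF; split=> [/(resolves hF)[w ew] | [w ->]].
  by exists (w 0); have /rowP/(_ k0) := ew; rewrite !mxE.
apply/(resolves hF); exists (\row_j w j).
apply: (resolution_row0 (k0 := k0) hF).
by rewrite !mxE; apply: eq_bigr => j _; rewrite mxE.
Qed.

(** [I] is an arbitrary predicate here; its closure under linear combinations is inherited from the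
    image of [differential F 0]. *)
Lemma resolution_ideal_sum (K : fieldType) (n N : nat)
    (I : {mpoly K[n]} -> Prop) (F : free_seq K n) (k0 : 'I_(size (twists F 0)))
    (h c : 'I_N -> {mpoly K[n]}) :
    minimal_graded_free_resolution I F -> (forall i, I (h i)) ->
  I (\sum_i c i * h i).
Proof.
move=> hF Ih.
have /fin_all_exists[w ew] i := (resolution_idealP k0 (h i) hF).1 (Ih i).
apply/(resolution_idealP k0 _ hF); exists (fun j => \sum_i c i * w i j).
under eq_bigr do rewrite ew mulr_sumr.
rewrite exchange_big; apply: eq_bigr => j _; rewrite mulr_suml.
by apply: eq_bigr => i _; rewrite mulrA.
Qed.

Lemma resolution_quadrics (K : fieldType) (n : nat) (I : {mpoly K[n]} -> Prop)
    (F : free_seq K n) (k0 : 'I_(size (twists F 0))) j :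
    minimal_graded_free_resolution I F ->
    (forall x, x \in twists F 1 -> x = 2%:Z) ->
  differential F 0 j k0 \is 2.-homog.
Proof.
move=> hF tw1; apply/dhomogP=> m /(graded hF).
rewrite (tw1 (twists F 1)`_j) ?mem_nth //.
have -> : (twists F 0)`_k0 = 0.
  by move: (k0); rewrite (starts_with_ring hF) => -[[]].
by rewrite subr0 => -[].
Qed.

(* The monomials of exponents mu 0, ..., mu (N-1) form a basis of I_d, provided
   that I is a monomial ideal. *)
Definition degree_basis (K : fieldType) (n d N : nat)
    (I : {mpoly K[n]} -> Prop) (mu : 'I_N -> 'X_{1..n}) : Prop :=
  [/\ injective mu, forall i, mdeg (mu i) = d, forall i, I 'X_[mu i] &
      forall p m, I p -> m \in msupp p -> mdeg m = d -> exists i, m = mu i].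

Lemma degree_basis_eq0 (K : fieldType) (n d N : nat)
    (I : {mpoly K[n]} -> Prop) (mu : 'I_N -> 'X_{1..n}) p :
    degree_basis d I mu -> I p -> p \is d.-homog ->
    (forall i, p@_(mu i) = 0) -> p = 0.
Proof.
move=> [_ _ _ mu_gen] Ip /dhomogP p_hom p_mu; apply/mpolyP=> m; rewrite mcoeff0.
apply/eqP; rewrite mcoeff_eq0; apply/negP=> m_p.
have [i em] := mu_gen _ _ Ip m_p (p_hom _ m_p).
by move: m_p; rewrite mcoeff_msupp em p_mu eqxx.
Qed.

Lemma degree_basis_coord (K : fieldType) (n d N : nat)
    (I : {mpoly K[n]} -> Prop) (F : free_seq K n) (k0 : 'I_(size (twists F 0)))
    (mu : 'I_N -> 'X_{1..n}) (v : 'I_N -> K) :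
    minimal_graded_free_resolution I F -> degree_basis d I mu ->
  exists2 p, I p & forall i, p@_(mu i) = v i.
Proof.
move=> hF [mu_inj _ muI _]; exists (\sum_i (v i)%:MP * 'X_[mu i]).
  exact: (resolution_ideal_sum k0).
move=> i; rewrite raddf_sum /= (bigD1 i) //= mcoeffCM mcoeffX eqxx mulr1.
rewrite big1 ?addr0 // => j /negPf neq_ji.
by rewrite mcoeffCM mcoeffX (inj_eq mu_inj) neq_ji mulr0.
Qed.

Lemma number_of_generators (K : fieldType) (n N : nat)
    (I : {mpoly K[n]} -> Prop) (F : free_seq K n) (mu : 'I_N -> 'X_{1..n}) :
    minimal_graded_free_resolution I F ->
    (forall x, x \in twists F 1 -> x = 2%:Z) ->
    degree_basis 2 I mu ->
  size (twists F 1) = N.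
Proof.
move=> hF tw1 mu_basis.
have k0 : 'I_(size (twists F 0)) by rewrite (starts_with_ring hF); exact: ord0.
pose g j := differential F 0 j k0.
have g_hom j : g j \is 2.-homog by exact: (resolution_quadrics k0 j hF).
(* Coordinates of the quadric with constant coefficients [c] in the monomial basis of I_2. *)
pose f (c : 'rV[K]_(size (twists F 1))) : 'rV[K]_N :=
  \row_i \sum_j c 0 j * (g j)@_(mu i).
have f_lin : linear f.
  move=> a c c'; apply/rowP=> i; rewrite !mxE mulr_sumr -big_split /=.
  by apply: eq_bigr => j _; rewrite !mxE mulrDl mulrA.
have f_inj : injective f.
  move=> c c' ecc'; apply/eqP; rewrite -subr_eq0; apply/eqP.
  apply: (const_syzygy_eq0 hF); apply: (resolution_row0 (k0 := k0) hF).
  rewrite [RHS]mxE.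
  apply: (degree_basis_eq0 mu_basis).
  - apply/(resolution_idealP k0 _ hF).
    by eexists; rewrite mxE; apply: eq_bigr.
  - rewrite mxE rpred_sum // => j _; rewrite mxE mul_mpolyC.
    by apply: rpredZ; exact: g_hom.
  - move=> i; rewrite mxE raddf_sum /=.
    have /rowP/(_ i) : f c = f c' by [].
    rewrite !mxE => /eqP; rewrite -subr_eq0 -sumrB => /eqP e0.
    rewrite -[RHS]e0; by apply: eq_bigr => j _; rewrite !mxE mcoeffCM mulrBl.
(* A zero space as third term turns exactness into surjectivity of [f]. *)
have f_surj v : 0 = 0 :> 'rV[K]_0 <-> exists c, f c = v.
  split=> // _; have [p Ip ep] := degree_basis_coord k0 (v 0) hF mu_basis.
  have [w ew] := (resolution_idealP k0 p hF).1 Ip.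
  (* In degree 2 only the constant terms of the coefficients of the quadrics matter. *)
  exists (\row_j (w j)@_0%MM); apply/rowP=> i; rewrite mxE -ep ew raddf_sum /=.
  have [_ mu_deg _ _] := mu_basis.
  apply: eq_bigr => j _; rewrite mxE (mcoeffM_lowest (d := 2)) //.
  by move=> m m_g; have /dhomogP/(_ m m_g) /= -> := g_hom j.
have zero_lin : linear (fun _ : 'rV[K]_N => 0 : 'rV[K]_0).
  by move=> a u v; rewrite scaler0 addr0.
have := dim_short_exact f_lin zero_lin f_inj f_surj.
rewrite !dim_mx !mul1n addn0 => -> //.
by move=> w; exists 0; apply/rowP=> -[].
Qed.

Lemma differential_comp (K : fieldType) (n : nat) (I : {mpoly K[n]} -> Prop)
    (F : free_seq K n) (i : nat) :
    minimal_graded_free_resolution I F ->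
  differential F i.+1 *m differential F i = 0.
Proof.
move=> hF; apply/row_matrixP=> l; rewrite row_mul row0.
by apply/(exactness hF); exists (delta_mx 0 l); rewrite -rowE.
Qed.

(** Dimension count for 0 -> K^S -> (R_1)^q -> I_3 -> 0, where [S] collects the rows of twist 3. *)
Lemma number_of_linear_syzygies (K : fieldType) (n N : nat)
    (I : {mpoly K[n]} -> Prop) (F : free_seq K n) (mu : 'I_N -> 'X_{1..n}) :
    minimal_graded_free_resolution I F ->
    (forall x, x \in twists F 1 -> x = 2%:Z) ->
    degree_basis 3 I mu ->
  (size (twists F 1) * n)%N = (count (pred1 3%:Z) (twists F 2) + N)%N.
Proof.
move=> hF tw1 mu_basis; have [_ mu_deg _ _] := mu_basis.
have k0 : 'I_(size (twists F 0)) by rewrite (starts_with_ring hF); exact: ord0.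
pose g j := differential F 0 j k0.
pose h (l : 'I_(size (twists F 2))) j := differential F 1 l j.
pose S := [set l : 'I_(size (twists F 2)) | (twists F 2)`_l == 3%:Z].
have g_hom j : g j \is 2.-homog by exact: (resolution_quadrics k0 j hF).
have h_zhom (l : 'I__) j : zhomog ((twists F 2)`_l - 2%:Z) (h l j).
  by have := @graded _ _ _ _ hF 1 l j; rewrite (tw1 (twists F 1)`_j) ?mem_nth.
have h_hom l j : l \in S -> h l j \is 1.-homog.
  rewrite inE => /eqP tw; apply/dhomogP=> m /h_zhom.
  by rewrite tw /= => -[].
(* A linear monomial in row [l] would force its twist to be 2 + 1. *)
have h_notS l j k : l \notin S -> (h l j)@_U_(k)%MM = 0.
  rewrite inE => tw; apply/eqP; rewrite mcoeff_eq0.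
  apply: contra tw => /h_zhom; rewrite mdeg1 => tw.
  by rewrite -[X in X == _](subrK 2%:Z) -tw.
have hg l : \sum_j h l j * g j = 0.
  have /matrixP/(_ l k0) := differential_comp 0 hF.
  by rewrite !mxE.
(* Entry (j, k) of a matrix stands for the coefficient of X_k in the j-th linear form. [f] combines
   the rows of twist 3; [e] multiplies the forms by the quadrics and reads off coordinates in
   I_3. *)
pose f (c : 'rV[K]_#|S|) : 'M[K]_(size (twists F 1), n) :=
  \matrix_(j, k) \sum_l c 0 l * (h (enum_val l) j)@_U_(k)%MM.
pose e (A : 'M[K]_(size (twists F 1), n)) : 'rV[K]_N :=
  \row_i \sum_j \sum_k A j k * ('X_k * g j)@_(mu i).
have f_lin : linear f.
  move=> a c c'; apply/matrixP=> j k; rewrite !mxE mulr_sumr -big_split /=.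
  by apply: eq_bigr => l _; rewrite !mxE mulrDl mulrA.
have e_lin : linear e.
  move=> a A A'; apply/rowP=> i; rewrite !mxE mulr_sumr -big_split /=.
  apply: eq_bigr => j _; rewrite mulr_sumr -big_split /=.
  by apply: eq_bigr => k _; rewrite !mxE mulrDl mulrA.
have eE A i : e A 0 i = (\sum_j linear_form (A j) * g j)@_(mu i).
  rewrite mxE raddf_sum; apply: eq_bigr => j _ /=.
  by rewrite mcoeff_linear_formM.
have f_inj : injective f.
  suff f0 c : f c = 0 -> c = 0.
    move=> c c' ecc'; apply/eqP; rewrite -subr_eq0; apply/eqP/f0.
    apply/matrixP=> j k; have /matrixP/(_ j k) : f c = f c' by [].
    rewrite !mxE => /eqP; rewrite -subr_eq0 -sumrB => /eqP e0.
    by rewrite -[RHS]e0; apply: eq_bigr => l _; rewrite !mxE mulrBl.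
  move=> fc0.
  (* [w] extends [c] by zero from [S] to all of F_2, so that [const_syzygy_eq0] applies. *)
  pose w : 'rV[K]_(size (twists F 2)) :=
    \row_l' \sum_l c 0 l * (enum_val l == l')%:R.
  have w_sum (G : _ -> K) :
      \sum_l' w 0 l' * G l' = \sum_l c 0 l * G (enum_val l).
    under eq_bigr do rewrite mxE mulr_suml.
    rewrite exchange_big; apply: eq_bigr => l _ /=.
    rewrite (bigD1 (enum_val l)) //= eqxx mulr1 big1 ?addr0 // => l' neq_l.
    by rewrite eq_sym (negPf neq_l) mulr0 mul0r.
  have w0 : w = 0.
    apply: (const_syzygy_eq0 hF); apply/rowP=> j; apply/mpolyP=> m.
    rewrite !mxE mcoeff0 raddf_sum /=.
    under eq_bigr do rewrite mxE mcoeffCM.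
    rewrite (w_sum (fun l => (h l j)@_m)).
    have [/mdeg1P[k /eqP->]|dm] := boolP (mdeg m == 1%N).
      by have /matrixP/(_ j k) := fc0; rewrite !mxE.
    apply: big1 => l _.
    by rewrite (dhomog_nemf_coeff (h_hom _ _ (enum_valP l)) dm) mulr0.
  apply/rowP=> l; rewrite !mxE.
  have := congr1 (fun u : 'rV_ _ => u 0 (enum_val l)) w0; rewrite !mxE => <-.
  rewrite (bigD1 l) //= eqxx mulr1 big1 ?addr0 // => l' neq_l.
  by rewrite (inj_eq enum_val_inj) (negPf neq_l) mulr0.
have fe_exact A : e A = 0 <-> exists c, f c = A.
  split=> [eA0 | [c <-]].
    have p0 : \sum_j linear_form (A j) * g j = 0.
      apply: (degree_basis_eq0 mu_basis).
      - by apply/(resolution_idealP k0 _ hF); eexists.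
      - rewrite rpred_sum // => j _; apply: (dhomogM (d := 1)) => //.
        exact: linear_form_homog.
      - by move=> i; rewrite -eE eA0 mxE.
    have /(exactness hF)[w ew] :
        (\row_j linear_form (A j)) *m differential F 0 = 0.
      apply: (resolution_row0 (k0 := k0) hF); rewrite !mxE -[RHS]p0.
      by apply: eq_bigr => j _; rewrite mxE.
    exists (\row_l (w 0 (enum_val l))@_0%MM); apply/matrixP=> j k.
    have /rowP/(_ j) := ew; rewrite !mxE => /(congr1 (mcoeff U_(k)%MM)).
    rewrite mcoeff_linear_form => <-; rewrite raddf_sum /=.
    (* The entries of [h] have no constant term, so the coefficient of X_k sees only the constant
       terms of [w]; rows outside [S] have no linear part and drop out. *)
    transitivity (\sum_(l in S) (w 0 l)@_0%MM * (h l j)@_U_(k)%MM).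
      by rewrite [RHS]big_enum_val; apply: eq_bigr => l _; rewrite mxE.
    rewrite [LHS]big_mkcond; apply: eq_bigr => l _ /=.
    rewrite (mcoeffM_lowest (d := 1)) ?mdeg1 //; last first.
      by move=> m; apply: irrelevant_ideal_mdeg; exact: (minimality hF).
    by case: ifPn => // /h_notS ->; rewrite mulr0.
  apply/rowP=> i; rewrite eE [RHS]mxE.
  suff -> : \sum_j linear_form (f c j) * g j = 0 by rewrite mcoeff0.
  (* The linear forms encoded by [f c] are a combination of rows of the differential, and [hg] says
     that each row is a syzygy. *)
  have lfE j : linear_form (f c j) = \sum_l c 0 l *: h (enum_val l) j.
    rewrite [RHS]linear_formE; last first.
      by apply: rpred_sum => l _; apply: rpredZ; exact: h_hom (enum_valP l).
    apply: eq_bigr => k _; rewrite mxE raddf_sum /=; congr (_ *: _).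
    by apply: eq_bigr => l _; rewrite mcoeffZ.
  under eq_bigr do rewrite lfE mulr_suml.
  rewrite exchange_big big1 // => l _.
  under eq_bigr do rewrite -scalerAl.
  by rewrite -scaler_sumr hg scaler0.
have e_surj v : exists A, e A = v.
  have [p Ip ep] := degree_basis_coord k0 (v 0) hF mu_basis.
  have [w ew] := (resolution_idealP k0 p hF).1 Ip.
  (* Against quadrics, only the linear parts of the coefficients [w j] reach degree 3. *)
  exists (\matrix_(j, k) (w j)@_U_(k)%MM); apply/rowP=> i.
  rewrite mxE -ep ew raddf_sum /=; apply: eq_bigr => j _.
  rewrite (mcoeffM_homog_linear _ (g_hom j)) //.
  by apply: eq_bigr => k _; rewrite mxE.
have := dim_short_exact f_lin e_lin f_inj fe_exact e_surj.
rewrite !dim_mx !mul1n => ->; congr (_ + _)%N.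
rewrite -sum1_card -sum1_count (big_nth 0) big_mkord.
by apply: eq_bigl => l; rewrite inE.
Qed.

(** * Monomial bases of edge ideals in degrees 2 and 3 *)

Lemma edge_ideal_monomial (K : fieldType) (n : nat) (e : rel 'I_n) i j m :
  e i j -> edge_ideal e ('X_[m + (U_(i) + U_(j))] : {mpoly K[n]}).
Proof.
move=> e_ij; exists [:: ('X_[m], 'X_i * 'X_j)].
  by move=> x; rewrite inE => /eqP->; exists i, j.
by rewrite big_seq1 /= -!mpolyXD.
Qed.

Lemma edge_ideal_msupp (K : fieldType) (n : nat) (e : rel 'I_n)
    (p : {mpoly K[n]}) m :
    edge_ideal e p -> m \in msupp p ->
  exists i j m', e i j /\ m = (m' + (U_(i) + U_(j)))%MM.
Proof.
case=> s s_edge -> /msupp_sum_le /flatten_mapP[x].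
rewrite mem_filter => /andP[_ /s_edge[i [j [e_ij ->]]]].
rewrite -mpolyXD (perm_mem (msuppMX _ _)) => /mapP[m' _ ->].
by exists i, j, m'; split; rewrite // addmC.
Qed.

Lemma addmCA (n : nat) : left_commutative (@mnm_add n).
Proof. by move=> m1 m2 m3; rewrite addmA [(m1 + m2)%MM]addmC -addmA. Qed.

Lemma mnm1D_eq (n : nat) (a c : 'I_n) (m m' : 'X_{1..n}) :
  (U_(a) + m = U_(c) + m')%MM -> a = c /\ m = m' \/ a <> c /\ (0 < m' a)%N.
Proof.
move=> em; have [eac|neq] := eqVneq a c; [left | right].
  by split=> //; move: em; rewrite eac => /addmI.
split; first exact/eqP.
have /mnmP/(_ a) := em; rewrite !mnmDE !mnm1E eqxx eq_sym (negPf neq); lia.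
Qed.

Lemma mnm1D2_eq (n : nat) (a b c d : 'I_n) :
  (U_(a) + U_(b) = U_(c) + U_(d))%MM -> a = c /\ b = d \/ a = d /\ b = c.
Proof.
move=> em; have [[-> /mnmP/(_ d)]|[_]] := mnm1D_eq em.
  by rewrite !mnm1E eqxx; case: eqP => // -> _; left.
rewrite mnm1E; case: eqP => // eda _; right; split=> //.
move: em; rewrite eda addmC => /addIm/mnmP/(_ c).
by rewrite !mnm1E eqxx; case: eqP.
Qed.

Definition edge_pairs (n : nat) (e : rel 'I_n) : {set 'I_n * 'I_n} :=
  [set p : 'I_n * 'I_n | (p.1 < p.2)%N && e p.1 p.2].

Lemma edge_pairs_degree_basis (K : fieldType) (n : nat) (e : rel 'I_n) :
    ssrbool.symmetric e -> irreflexive e ->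
  degree_basis 2 (@edge_ideal K n e)
    (fun l : 'I_#|edge_pairs e| =>
       (U_((enum_val l).1) + U_((enum_val l).2))%MM).
Proof.
move=> e_sym e_irr; split.
- move=> l l'; have := enum_valP l; have := enum_valP l'; rewrite !inE.
  move=> /andP[lt_l' _] /andP[lt_l _] /mnm1D2_eq[[]|[]] e1 e2.
    apply: enum_val_inj.
    by rewrite [LHS]surjective_pairing e1 e2 -surjective_pairing.
  by move: lt_l; rewrite e1 e2 ltnNge (ltnW lt_l').
- by move=> l; rewrite mdegD !mdeg1.
- move=> l; have := enum_valP l; rewrite inE => /andP[_ e_l].
  by have := edge_ideal_monomial K 0%MM e_l; rewrite add0m.
- move=> p m /edge_ideal_msupp ep /ep[i [j [m' [e_ij ->]]]].
  rewrite !mdegD !mdeg1 => dm.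
  have /eqP -> : m' == 0%MM by rewrite -mdeg_eq0; lia.
  have [lt_ij|lt_ji|/val_inj eij] := ltngtP i j.
  + have ij : (i, j) \in edge_pairs e by rewrite inE lt_ij.
    by exists (enum_rank_in ij (i, j)); rewrite enum_rankK_in // add0m.
  + have ji : (j, i) \in edge_pairs e by rewrite inE e_sym lt_ji.
    by exists (enum_rank_in ji (j, i)); rewrite enum_rankK_in // add0m addmC.
  + by move: e_ij; rewrite eij e_irr.
Qed.

(* In a triangle-free graph the cubic monomial of a path k - i - j arises both
   from k and the edge ij and from j and the edge ki; this selects the pair
   whose extra vertex is the larger endpoint of the path. *)
Definition canonical_triple (n : nat) (e : rel 'I_n) (k i j : 'I_n) : bool :=
  [&& e i j, ~~ (e k i && (k < j)%N) & ~~ (e k j && (k < i)%N)].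

Definition edge_triples (n : nat) (e : rel 'I_n) : {set 'I_n * ('I_n * 'I_n)} :=
  [set p : 'I_n * ('I_n * 'I_n) |
    (p.2.1 < p.2.2)%N && canonical_triple e p.1 p.2.1 p.2.2].

Definition triangle_free (n : nat) (e : rel 'I_n) : Prop :=
  forall i j k, e i j -> e j k -> ~~ e i k.

Lemma canonical_tripleC (n : nat) (e : rel 'I_n) (k i j : 'I_n) :
  ssrbool.symmetric e -> canonical_triple e k i j = canonical_triple e k j i.
Proof.
by move=> e_sym; rewrite /canonical_triple e_sym; congr (_ && _); rewrite andbC.
Qed.

Lemma canonical_triple_mem (n : nat) (e : rel 'I_n) (k i j : 'I_n) :
    ssrbool.symmetric e -> irreflexive e -> canonical_triple e k i j ->
  exists2 c, c \in edge_triples e &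
    (U_(c.1) + (U_(c.2.1) + U_(c.2.2)))%MM = (U_(k) + (U_(i) + U_(j)))%MM.
Proof.
move=> e_sym e_irr c_kij.
have [lt_ij|lt_ji|/val_inj eij] := ltngtP i j.
- by exists (k, (i, j)); rewrite // inE /= lt_ij.
- exists (k, (j, i)); first by rewrite inE /= lt_ji canonical_tripleC.
  by congr (_ + _)%MM; rewrite addmC.
- by move: c_kij; rewrite /canonical_triple eij e_irr.
Qed.

(** If the triple is not canonical, then k is adjacent to one end of the edge and smaller than the
    other. Exchanging k with that other end keeps the monomial, and triangle-freeness makes the new
    triple canonical. *)
Lemma edge_triples_cover (n : nat) (e : rel 'I_n) (k i j : 'I_n) :
    ssrbool.symmetric e -> irreflexive e -> triangle_free e -> e i j ->
  exists2 c, c \in edge_triples e &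
    (U_(c.1) + (U_(c.2.1) + U_(c.2.2)))%MM = (U_(k) + (U_(i) + U_(j)))%MM.
Proof.
move=> e_sym e_irr e_tf e_ij.
have [|/nandP[]] := boolP (canonical_triple e k i j).
- exact: canonical_triple_mem.
- by rewrite e_ij.
rewrite -negb_or negbK; case/orP=> /andP[e_k lt_k].
  have [|c cE ec] := @canonical_triple_mem n e j k i e_sym e_irr.
    rewrite /canonical_triple e_k e_sym (negPf (e_tf _ _ _ e_k e_ij)) /=.
    by rewrite [(j < k)%N]ltnNge (ltnW lt_k) andbF.
  by exists c => //; rewrite ec addmC addmA.
have [|c cE ec] := @canonical_triple_mem n e i k j e_sym e_irr.
  have e_ji : e j i by rewrite e_sym.
  rewrite /canonical_triple e_k [e i k]e_sym (negPf (e_tf _ _ _ e_k e_ji)) /=.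
  by rewrite [(i < k)%N]ltnNge (ltnW lt_k) andbF.
by exists c => //; rewrite ec addmCA.
Qed.

(** If k and k' differ, each lies on the edge of the other triple, so both are joined to a common
    middle vertex. Canonicity of the two triples then excludes both k < k' and k' < k. *)
Lemma edge_triples_inj (n : nat) (e : rel 'I_n) :
    ssrbool.symmetric e ->
  {in edge_triples e &, injective (fun c : 'I_n * ('I_n * 'I_n) =>
     (U_(c.1) + (U_(c.2.1) + U_(c.2.2)))%MM)}.
Proof.
move=> e_sym [k [i j]] [k' [i' j']]; rewrite !inE /= /canonical_triple.
move=> /and4P[lt_ij e_ij c1 c2] /and4P[lt_ij' e_ij' c1' c2'] em.
have [[-> /mnm1D2_eq[[-> ->]//|[ei ej]]]|[neq_k]] := mnm1D_eq em.
  by move: lt_ij; rewrite ei ej ltnNge (ltnW lt_ij').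
rewrite mnmDE !mnm1E; case: (eqVneq i' k) => [ei' _|_].
  have em' : (U_(i) + U_(j) = U_(k') + U_(j'))%MM.
    by move: em; rewrite ei' [RHS]addmCA => /addmI.
  have neqv : k != k' :> nat by apply/eqP=> /val_inj.
  case/mnm1D2_eq: em' => -[ei ej]; subst; move: c1 c2 c1' c2';
    rewrite ?e_ij ?e_ij' ?[e j' _]e_sym ?e_ij ?e_ij' /=; lia.
case: (eqVneq j' k) => // ej' _.
have em' : (U_(i) + U_(j) = U_(k') + U_(i'))%MM.
  by move: em; rewrite ej' [(U_(i') + _)%MM]addmC [RHS]addmCA => /addmI.
have neqv : k != k' :> nat by apply/eqP=> /val_inj.
case/mnm1D2_eq: em' => -[ei ej]; subst; move: c1 c2 c1' c2';
    rewrite ?e_ij ?e_ij' ?[e _ i']e_sym ?e_ij ?e_ij' /=; lia.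
Qed.

Lemma edge_triples_degree_basis (K : fieldType) (n : nat) (e : rel 'I_n) :
    ssrbool.symmetric e -> irreflexive e -> triangle_free e ->
  degree_basis 3 (@edge_ideal K n e)
    (fun l : 'I_#|edge_triples e| => let c := enum_val l in
       (U_(c.1) + (U_(c.2.1) + U_(c.2.2)))%MM).
Proof.
move=> e_sym e_irr e_tf; split.
- move=> l l' /edge_triples_inj ell'.
  by apply: enum_val_inj; apply: ell' => //; apply: enum_valP.
- by move=> l; rewrite !mdegD !mdeg1.
- move=> l; have := enum_valP l; rewrite inE => /and3P[_ e_l _].
  exact: edge_ideal_monomial.
- move=> p m /edge_ideal_msupp ep /ep[i [j [m' [e_ij ->]]]].
  rewrite !mdegD !mdeg1 => dm.
  have /mdeg1P[k /eqP->] : mdeg m' == 1%N by lia.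
  have [c cE <-] := edge_triples_cover k e_sym e_irr e_tf e_ij.
  by exists (enum_rank_in cE c); rewrite enum_rankK_in.
Qed.

(** * Counting edges and paths with two edges *)

Definition degree (n : nat) (e : rel 'I_n) (i : 'I_n) : nat :=
  (\sum_j e i j)%N.

(** Handshake lemma. *)
Lemma double_card_edge_pairs (n : nat) (e : rel 'I_n) :
    ssrbool.symmetric e -> irreflexive e ->
  (#|edge_pairs e| * 2 = \sum_i degree e i)%N.
Proof.
move=> e_sym e_irr.
have cardE : (#|edge_pairs e| = \sum_(i < n) \sum_(j < n) ((i < j) && e i j))%N.
  rewrite -sum1_card big_mkcond pair_bigA.
  by apply: eq_bigr => p _; rewrite inE; case: ifP.
rewrite muln2 -addnn {1}cardE exchange_big cardE -big_split.
apply: eq_bigr => i _; rewrite -big_split; apply: eq_bigr => j _ /=.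
rewrite [e j i]e_sym.
have [_|_|/val_inj->] := ltngtP i j; rewrite ?e_irr //=; lia.
Qed.

(** The middle vertex is i; ordering the ends counts each path once. *)
Definition path_count (n : nat) (e : rel 'I_n) : nat :=
  (\sum_(k < n) \sum_(i < n) \sum_(j < n) [&& (k < j)%N, e k i & e i j])%N.

(** Among all pairs of a vertex and an edge, the non-canonical ones correspond to the paths with two
    edges. *)
Lemma card_edge_triples (n : nat) (e : rel 'I_n) :
    ssrbool.symmetric e -> irreflexive e -> triangle_free e ->
  (#|edge_pairs e| * n = path_count e + #|edge_triples e|)%N.
Proof.
move=> e_sym e_irr e_tf.
have -> : (#|edge_pairs e| * n =
    \sum_(k < n) \sum_(i < n) \sum_(j < n) ((i < j) && e i j))%N.
  rewrite sum_nat_const card_ord mulnC; congr (_ * _)%N.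
  rewrite -sum1_card big_mkcond pair_bigA.
  by apply: eq_bigr => p _; rewrite inE; case: ifP.
have -> : (#|edge_triples e| =
    \sum_(k < n) \sum_(i < n) \sum_(j < n)
      ((i < j) && canonical_triple e k i j))%N.
  rewrite -sum1_card big_mkcond; under [RHS]eq_bigr do rewrite pair_bigA.
  by rewrite pair_bigA; apply: eq_bigr => p _; rewrite inE; case: ifP.
(* Each path is filed under its edge at the larger end, written with i < j; its middle vertex is
   then either i or j. *)
have -> : path_count e =
    (\sum_(k < n) \sum_(i < n) \sum_(j < n) ([&& k < j, i < j, e k i & e i j] +
                           [&& k < i, i < j, e k j & e i j]))%N.
  rewrite /path_count; apply: eq_bigr => k _.
  under [RHS]eq_bigr do rewrite big_split.
  rewrite big_split /= [X in (_ + X)%N]exchange_big -big_split.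
  apply: eq_bigr => i _; rewrite -big_split; apply: eq_bigr => j _ /=.
  rewrite [e j i]e_sym.
  have [_|_|/val_inj->] := ltngtP i j; rewrite ?e_irr /= ?andbF //; lia.
rewrite -big_split; apply: eq_bigr => k _.
rewrite -big_split; apply: eq_bigr => i _.
rewrite -big_split; apply: eq_bigr => j _ /=; rewrite /canonical_triple.
(* The identity now holds term by term, because k is adjacent to at most one end of the edge. *)
have [e_ij|] := boolP (e i j); last by rewrite !andbF.
have := e_tf k i j; rewrite e_ij.
case: (e k i) (e k j) (i < j)%N => -[] [] //=; lia.
Qed.

(** The squared degrees count walks k - i - j by their middle vertex. Walks with k < j and with k >
    j are each as many as the paths, and those with k = j add up to the degree sum. *)
Lemma double_path_count (n : nat) (e : rel 'I_n) :
    ssrbool.symmetric e ->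
  (path_count e * 2 + \sum_i degree e i = \sum_i degree e i ^ 2)%N.
Proof.
move=> e_sym.
have -> : (\sum_i degree e i ^ 2 =
    \sum_(k < n) \sum_(i < n) \sum_(j < n) (e k i && e i j))%N.
  rewrite exchange_big; apply: eq_bigr => i _.
  rewrite expnS expn1 /degree big_distrl; apply: eq_bigr => k _ /=.
  by rewrite big_distrr; apply: eq_bigr => j _; rewrite /= [e k i]e_sym mulnb.
have degE : (\sum_i degree e i =
    \sum_(k < n) \sum_(i < n) \sum_(j < n) [&& k == j, e k i & e i j])%N.
  apply: eq_bigr => k _; apply: eq_bigr => i _.
  rewrite (bigD1 k) //= eqxx [e i k]e_sym andbb big1 ?addn0 // => j.
  by rewrite eq_sym => /negPf->.
have pathE : path_count e =
    (\sum_(k < n) \sum_(i < n) \sum_(j < n) [&& (j < k)%N, e k i & e i j])%N.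
  rewrite /path_count [RHS]exchange_big [LHS]exchange_big.
  apply: eq_bigr => i _; rewrite exchange_big; apply: eq_bigr => k _.
  apply: eq_bigr => j _ /=.
  by rewrite [e j i]e_sym [e i k]e_sym; congr (_ && _ : nat); rewrite andbC.
rewrite degE muln2 -addnn {2}pathE /path_count -!big_split.
apply: eq_bigr => k _; rewrite -!big_split; apply: eq_bigr => i _.
rewrite -!big_split; apply: eq_bigr => j _ /=.
rewrite -(inj_eq val_inj) /=; case: ltngtP; lia.
Qed.

(** The algebraic and the combinatorial expression for q n both contain dim I_3, the number of edge
    triples; cancelling it leaves the paths. *)
Lemma triangle_free_edge_ideal_betti (K : fieldType) (n : nat)
    (e : rel 'I_n) (F : free_seq K n) :
    ssrbool.symmetric e -> irreflexive e -> triangle_free e ->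
    minimal_graded_free_resolution (@edge_ideal K n e) F ->
    (forall x, x \in twists F 1 -> x = 2%:Z) ->
  (size (twists F 1) * 2 = \sum_i degree e i)%N /\
  (count (pred1 3%:Z) (twists F 2) * 2 + \sum_i degree e i
     = \sum_i degree e i ^ 2)%N.
Proof.
move=> e_sym e_irr e_tf hF tw1.
have q_card := number_of_generators hF tw1
  (edge_pairs_degree_basis K e_sym e_irr).
have := number_of_linear_syzygies hF tw1
  (edge_triples_degree_basis K e_sym e_irr e_tf).
rewrite q_card card_edge_triples // => /addIn b_count.
by rewrite double_card_edge_pairs // -b_count double_path_count.
Qed.

(** * The grid *)

(** Adjacent labels differ by 1 or t + 1, so a triangle would need 1 + 1 = t + 1. For t = 1 the rows
    have only two vertices, which rules out two consecutive horizontal steps. *)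
Lemma B2t_triangle_free (t : nat) : triangle_free (@B2t t).
Proof. by move=> i j k; rewrite /B2t /grid_edge; lia. Qed.

(* The summands are the neighbours of i to the right, to the left, below and
   above; the excluded values are the ends of the three rows. *)
Lemma B2tE (t : nat) (i j : 'I_(3 * t + 3)) :
  B2t i j =
  (((j == i.+1 :> nat) &&
      [&& i != t :> nat, i != (2 * t).+1 :> nat & i != (3 * t).+2 :> nat]) +
   ((i == j.+1 :> nat) &&
      [&& i != 0 :> nat, i != t.+1 :> nat & i != (2 * t).+2 :> nat]) +
   ((j == i + t.+1 :> nat) && (i < (2 * t).+2)) +
   ((i == j + t.+1 :> nat) && (t < i)))%N :> nat.
Proof.
have := ltn_ord i; have := ltn_ord j; rewrite /B2t /grid_edge.
move: (nat_of_ord i) (nat_of_ord j) => {}i {}j jn iN.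
(* The four neighbour equations are decided in turn. The inner case splits isolate t = 0, where the
   horizontal and vertical steps coincide. *)
case: (eqVneq j i.+1) jn => [->|rt] jn.
  have -> : (i == i.+2) = false by lia.
  have -> : (i == i.+1 + t.+1) = false by lia.
  case: (eqVneq i.+1 (i + t.+1)) => [e|d]; lia.
case: (eqVneq i j.+1) iN rt => [->|lf] iN rt.
  have -> : (j == j.+1 + t.+1) = false by lia.
  case: (eqVneq j.+1 (j + t.+1)) => [e|d]; lia.
case: (eqVneq j (i + t.+1)) jn rt lf => [->|up] jn rt lf.
  have -> : (i == i + t.+1 + t.+1) = false by lia.
  lia.
case: (eqVneq i (j + t.+1)) iN rt lf up => [->|dn] iN rt lf up.
  lia.
lia.
Qed.

(** What remains of [B2tE] once j is summed out: one indicator per direction, for the 0-based index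
    i. *)
Definition grid_degree (t i : nat) : nat :=
  ([&& i != t, i != (2 * t).+1 & i != (3 * t).+2] +
   [&& i != 0, i != t.+1 & i != (2 * t).+2] +
   (i < (2 * t).+2) + (t < i))%N.

Lemma sum_ord_eq (n x : nat) (c : bool) :
  (c -> (x < n)%N) -> (\sum_(j < n) ((j == x :> nat) && c) = c)%N.
Proof.
case: c => [/(_ isT) lt_xn|_]; last by apply: big1 => j _; rewrite andbF.
rewrite (bigD1 (Ordinal lt_xn)) //= eqxx big1 // => j.
by rewrite -(inj_eq val_inj) /= => /negPf->.
Qed.

Lemma degree_B2t (t : nat) (i : 'I_(3 * t + 3)) :
  degree (@B2t t) i = grid_degree t i.
Proof.
have lt_i := ltn_ord i.
rewrite /degree; under eq_bigr do rewrite B2tE.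
rewrite !big_split /=; congr (_ + _ + _ + _)%N.
- by apply: sum_ord_eq; lia.
(* Truncation in [i.-1], and in [i - t.+1] below, is harmless: the accompanying condition fails
   whenever it occurs. *)
- rewrite -[RHS](@sum_ord_eq (3 * t + 3) i.-1); last lia.
  by apply: eq_bigr => j _; lia.
- by apply: sum_ord_eq; lia.
- rewrite -[RHS](@sum_ord_eq (3 * t + 3) (i - t.+1)); last lia.
  by apply: eq_bigr => j _; lia.
Qed.

(** For t = s + 1 a row has s + 2 vertices: two ends and [s] inner vertices, which share one
    degree. *)
Lemma sum_row (G : nat -> nat) (x s c : nat) :
    (forall i, x < i < x + s.+1 -> G i = c)%N ->
  (\sum_(x <= i < x + s.+2) G i = G x + G (x + s.+1) + s * c)%N.
Proof.
move=> Gc; rewrite big_ltn; last lia.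
rewrite addnS big_nat_recr /=; last lia.
rewrite (eq_big_nat _ _ (F2 := fun=> c)) => [|i].
  by rewrite sum_nat_const_nat; lia.
by move=> ?; apply: Gc; lia.
Qed.

(** A general [f] covers both the degree sum and the sum of squares. *)
Lemma sum_B2t (t : nat) (f : nat -> nat) : (1 <= t)%N ->
  (\sum_(i < 3 * t + 3) f (degree (@B2t t) i) =
     4 * f 2 + 2 * t * f 3 + t.-1 * f 4)%N.
Proof.
case: t => // s _; under eq_bigr do rewrite degree_B2t.
rewrite -(big_mkord xpredT (fun i => f (grid_degree s.+1 i))).
(* The vertices are cut into three rows. The outer rows have ends of degree 2 and inner degree 3;
   the middle row has ends of degree 3 and inner degree 4. *)
have -> : (3 * s.+1 + 3 = (0 + s.+2) + s.+2 + s.+2)%N by lia.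
rewrite (big_cat_nat (n := 0 + s.+2 + s.+2)) /=; [|lia|lia].
rewrite (big_cat_nat (n := 0 + s.+2)) /=; [|lia|lia].
rewrite (@sum_row _ 0 s (f 3%N)); last first.
  by move=> i ?; congr f; rewrite /grid_degree; lia.
rewrite (@sum_row _ (0 + s.+2) s (f 4%N)); last first.
  by move=> i ?; congr f; rewrite /grid_degree; lia.
rewrite (@sum_row _ (0 + s.+2 + s.+2) s (f 3%N)); last first.
  by move=> i ?; congr f; rewrite /grid_degree; lia.
have -> : grid_degree s.+1 0 = 2%N by rewrite /grid_degree; lia.
have -> : grid_degree s.+1 (0 + s.+1) = 2%N by rewrite /grid_degree; lia.
have -> : grid_degree s.+1 (0 + s.+2) = 3%N by rewrite /grid_degree; lia.
have -> : grid_degree s.+1 (0 + s.+2 + s.+1) = 3%N by rewrite /grid_degree; lia.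
have -> : grid_degree s.+1 (0 + s.+2 + s.+2) = 2%N by rewrite /grid_degree; lia.
have -> : grid_degree s.+1 (0 + s.+2 + s.+2 + s.+1) = 2%N
  by rewrite /grid_degree; lia.
rewrite mulnS mulnDl -mulnA; lia.
Qed.

Theorem theorem2p5 (t r : nat) (ht : (1 <= t)%N) (hr : r = (2 * t)%N)
  (K : fieldType) (F : free_seq K (3 * t + 3)) (q b c : nat)
  (hF : minimal_graded_free_resolution (@edge_ideal K (3 * t + 3) (@B2t t)) F)
  (hF1 : perm_eq (twists F 1) (nseq q (2%:Z)))
  (hF2 : perm_eq (twists F 2) (nseq c (4%:Z) ++ nseq b (3%:Z))) :
  (q%:R : rat) = 5%:R / 2%:R * r%:R + 2%:R /\
  (b%:R : rat) = 6%:R * r%:R - 2%:R.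
Proof.
have tw1 x : x \in twists F 1 -> x = 2%:Z.
  by rewrite (perm_mem hF1) => /nseqP[].
have := triangle_free_edge_ideal_betti (@B2t_sym t) (@B2t_irrefl t)
  (@B2t_triangle_free t) hF tw1.
rewrite (perm_size hF1) size_nseq (permP hF2) count_cat !count_nseq /=.
(* The degree sum is 10t + 4 and the sum of squares is 34t, so 2q = 10t + 4 and 2b = 24t - 4. *)
rewrite (sum_B2t id ht) (sum_B2t (fun d => d ^ 2)%N ht) => -[eq_q eq_b].
have -> : q = (5 * t + 2)%N by lia.
(* Stated additively because subtraction of naturals truncates. *)
have eb : (b + 2 = 12 * t)%N by lia.
rewrite hr; split; last first.
  apply/eqP; rewrite -subr_eq opprK -natrD eb -natrM; apply/eqP.
  by congr _%:R; lia.
by rewrite natrD !natrM mulrA divfK.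
Qed.
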